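(* Let $(\mathcal M,\psi)$ be a probability space, let $\mathcal M_0\subset\mathcal M_1\subset\mathcal M_2\subset\cdots$ be a tower of $\psi$-conditioned subalgebras with $\mathcal M=\bigvee_{n\in\mathbb N_0}\mathcal M_n$, and let $\alpha=\lim_{n\to\infty}\alpha_1\alpha_2\cdots\alpha_n$ be an adapted endomorphism with product representation by factors $(\alpha_n)_{n\in\mathbb N}\subset\mathrm{Aut}(\mathcal M,\psi)$ (with respect to this tower). Let $\mathcal M_{-1}$ be a $\psi$-conditioned subalgebra contained in $\mathcal M^\alpha\cap\mathcal M_0$, where $\mathcal M^\alpha$ is the fixed point algebra of $\alpha$, and suppose that for all $n\in\mathbb N$ $$\begin{matrix}\mathcal M_{n-1}&\subset&\mathcal M_n\\ \cup&&\cup\\ \mathcal M_{n-2}&\subset&\alpha_n(\mathcal M_{n-1})\end{matrix}$$ is a commuting square. In addition assume that for all $k\in\mathbb N$ we have $\alpha_k=\rho(\sigma_k)$ for a representation $\rho:\mathbb B_\infty\to\mathrm{Aut}(\mathcal M,\psi)$. Then for all $n\ge-1$ $$\mathcal M_n=\mathcal M_n^\rho,\qquad\text{where }\mathcal M_n^\rho:=\mathcal M^{\rho(\mathbb B_{n+2,\infty})}.$$ As a special case, if $\rho(\sigma_k)=\mathrm{Ad}\,u_k$ (with $u_k\in\mathcal M$ unitary) for all $k\ge n+2$, then $\mathcal M_n$ is equal to the relative commutant $\mathcal M\cap\{u_k\mid k\ge n+2\}'$.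
   Context: A probability space $(\mathcal M,\psi)$ is a von Neumann algebra $\mathcal M$ with separable predual together with a faithful normal state $\psi$. A von Neumann subalgebra $\mathcal B\subset\mathcal M$ is $\psi$-conditioned if the $\psi$-preserving conditional expectation $E_{\mathcal B}$ of $\mathcal M$ onto $\mathcal B$ exists. $\bigvee$ denotes the von Neumann algebra generated; $\mathrm{Aut}(\mathcal M,\psi)$ is the group of $\psi$-preserving automorphisms; $\mathbb N=\{1,2,\dots\}$, $\mathbb N_0=\{0,1,2,\dots\}$; $\mathrm{Ad}\,u=u\,\cdot\,u^*$. Adapted endomorphism with product representation: the automorphisms $\alpha_k\in\mathrm{Aut}(\mathcal M,\psi)$ satisfy, for all $n\in\mathbb N_0$, $\alpha_k(\mathcal M_n)=\mathcal M_n$ if $k\le n$ and $\alpha_k|_{\mathcal M_n}=\mathrm{id}|_{\mathcal M_n}$ if $k\ge n+2$; then $\alpha=\lim_{n\to\infty}\alpha_1\alpha_2\cdots\alpha_n$ exists in the pointwise strong operator topology and is a $\psi$-preserving endomorphism of $\mathcal M$. A square of inclusions of $\psi$-conditioned subalgebras with top row $\mathcal N_2\subset\mathcal P$ and bottom row $\mathcal N\subset\mathcal N_1$ is a commuting square if $E_{\mathcal N_1}E_{\mathcal N_2}=E_{\mathcal N}$. $\mathbb B_\infty$ is generated by $\sigma_1,\sigma_2,\dots$ subject to $\sigma_i\sigma_j\sigma_i=\sigma_j\sigma_i\sigma_j$ if $|i-j|=1$ and $\sigma_i\sigma_j=\sigma_j\sigma_i$ if $|i-j|>1$; $\mathbb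 B_{n,\infty}=\langle\sigma_k\mid k\ge n\rangle$; $\mathcal M^{\rho(\mathbb B_{n,\infty})}$ is the fixed point algebra of $\rho(\mathbb B_{n,\infty})$. *)

(* Defs.v *)
From HB Require Import structures.
From mathcomp Require Import all_boot all_order all_algebra.
From mathcomp Require Import generic_quotient.
From mathcomp Require Import all_classical all_reals all_analysis.
From mathcomp Require Import complex.

Set Implicit Arguments.
Unset Strict Implicit.
Unset Printing Implicit Defensive.

Import Order.TTheory GRing.Theory Num.Theory.
Import numFieldNormedType.Exports.

Local Open Scope classical_set_scope.
Local Open Scope ring_scope.
Local Open Scope complex_scope.
Local Open Scope quotient_scope.

(** * The braid group on infinitely many strands *)

(* A word is a sequence of letters; the letter [(i, true)] stands for
   sigma_{i+1} and [(i, false)] for its inverse. *)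
Definition braid_word := seq (nat * bool).

Inductive braid_rel : braid_word -> braid_word -> Prop :=
| braid_refl w : braid_rel w w
| braid_sym w1 w2 : braid_rel w1 w2 -> braid_rel w2 w1
| braid_trans w1 w2 w3 :
    braid_rel w1 w2 -> braid_rel w2 w3 -> braid_rel w1 w3
| braid_cat w1 w1' w2 w2' :
    braid_rel w1 w1' -> braid_rel w2 w2' ->
    braid_rel (w1 ++ w2) (w1' ++ w2')
| braid_cancel i b : braid_rel [:: (i, b); (i, ~~ b)] [::]
| braid_near i j : (i.+1 = j \/ j.+1 = i)%N ->
    braid_rel [:: (i, true); (j, true); (i, true)]
              [:: (j, true); (i, true); (j, true)]
| braid_far i j : (i.+1 < j \/ j.+1 < i)%N ->
    braid_rel [:: (i, true); (j, true)] [:: (j, true); (i, true)].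

Definition braid_relb (w1 w2 : braid_word) : bool := `[< braid_rel w1 w2 >].

Lemma braid_relb_refl : reflexive braid_relb.
Proof. by move=> w; apply/asboolP; exact: braid_refl. Qed.

Lemma braid_relb_sym : symmetric braid_relb.
Proof. by move=> v w; apply/asboolP/asboolP; exact: braid_sym. Qed.

Lemma braid_relb_trans : transitive braid_relb.
Proof.
move=> v u w /asboolP uv /asboolP vw; apply/asboolP.
exact: braid_trans uv vw.
Qed.

Canonical braid_equiv :=
  EquivRel braid_relb braid_relb_refl braid_relb_sym braid_relb_trans.

Definition braid_group := {eq_quot braid_equiv}%qT.
HB.instance Definition _ := Choice.on braid_group.

Definition braid_class (w : braid_word) : braid_group := \pi_braid_group w.

Definition braid_inv_word (w : braid_word) : braid_word :=
  rev [seq (x.1, ~~ x.2) | x <- w].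

Definition braid_one : braid_group := braid_class [::].
Definition braid_mul (g h : braid_group) : braid_group :=
  braid_class (repr g ++ repr h).
Definition braid_inv (g : braid_group) : braid_group :=
  braid_class (braid_inv_word (repr g)).

Lemma braid_classP v w : braid_rel v w <-> braid_class v = braid_class w.
Proof.
split=> [vw|]; first by apply/eqmodP/asboolP.
by move=> /eqmodP/asboolP.
Qed.

Lemma braid_repr w : braid_rel (repr (braid_class w)) w.
Proof. by apply/braid_classP; rewrite /braid_class reprK. Qed.

Lemma braid_class_repr g : braid_class (repr g) = g.
Proof. exact: reprK. Qed.

Lemma braid_class_cat v w :
  braid_mul (braid_class v) (braid_class w) = braid_class (v ++ w).
Proof. by apply/braid_classP; apply: braid_cat; exact: braid_repr. Qed.

Lemma braid_mulA : associative braid_mul.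
Proof.
move=> f g h; rewrite -(braid_class_repr f) -(braid_class_repr g).
by rewrite -(braid_class_repr h) !braid_class_cat catA.
Qed.

Lemma braid_mul1 : left_id braid_one braid_mul.
Proof. by move=> g; rewrite -(braid_class_repr g) braid_class_cat. Qed.

Lemma braid_mulr1 : right_id braid_one braid_mul.
Proof. by move=> g; rewrite -(braid_class_repr g) braid_class_cat cats0. Qed.

Lemma braid_inv_wordK : involutive braid_inv_word.
Proof.
move=> w; rewrite /braid_inv_word map_rev revK -map_comp map_id_in //.
by case=> i b _ /=; rewrite negbK.
Qed.

Lemma braid_rel_invl w : braid_rel (braid_inv_word w ++ w) [::].
Proof.
elim: w => [|[i b] w ih]; first exact: braid_refl.
rewrite /braid_inv_word /= rev_cons -/(braid_inv_word w) cat_rcons.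
apply: braid_trans ih; apply: braid_cat; first exact: braid_refl.
rewrite -[w in X in braid_rel _ X]cat0s -/(cat [:: (i, ~~ b); (i, b)] w).
apply: braid_cat; last exact: braid_refl.
by rewrite -{2}(negbK b); exact: braid_cancel.
Qed.

Lemma braid_rel_invr w : braid_rel (w ++ braid_inv_word w) [::].
Proof. by rewrite -{1}(braid_inv_wordK w); exact: braid_rel_invl. Qed.

Lemma braid_mulV : left_inverse braid_one braid_inv braid_mul.
Proof.
move=> g; rewrite -{2}(braid_class_repr g) /braid_inv braid_class_cat.
by apply/braid_classP; exact: braid_rel_invl.
Qed.

Lemma braid_mulrV : right_inverse braid_one braid_inv braid_mul.
Proof.
move=> g; rewrite -{1}(braid_class_repr g) /braid_inv braid_class_cat.
by apply/braid_classP; exact: braid_rel_invr.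
Qed.

HB.instance Definition _ := isGroup.Build braid_group
  braid_mulA braid_mul1 braid_mulr1 braid_mulV braid_mulrV.

Definition subgroup_generated (G : groupType) (S : set G) : set G :=
  \bigcap_(A in [set A : set G |
     [/\ S `<=` A, A 1%g,
         (forall g h, A g -> A h -> A (g * h)%g) &
         (forall g, A g -> A (g^-1)%g)]]) A.

(* The generators are sigma_1, sigma_2, ...; the value of [sigma] at 0 is
   never meant ([sigma 0 = sigma 1], so that no generator is added). *)
Definition sigma (k : nat) : braid_group := braid_class [:: (k.-1, true)].

(* B_{n,infty} *)
Definition braid_subgroup (n : nat) : set braid_group :=
  subgroup_generated [set g | exists2 k, (n <= k)%N & g = sigma k].

(** * Operators on a complex Hilbert space *)

(* A complex Hilbert space is a complete normed space [H] over [R[i]] whose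
   norm comes from the inner product [ip]; as in MathComp, [ip] is linear in
   its first argument and conjugate-linear in the second one. *)
Definition hilbert_norm (R : realType) (H : completeNormedModType R[i])
    (ip : {dot H for Num.conj}) : Prop :=
  forall v : H, `|v| ^+ 2 = ip v v.

Section Operators.
Context {R : realType} {H : completeNormedModType R[i]}.
Context (ip : {dot H for Num.conj}).

Implicit Types (A M N P S : set (H -> H)) (psi : (H -> H) -> R[i]).

Definition bounded_operators : set (H -> H) :=
  [set T | linear T /\ exists C : R[i], forall v, `|T v| <= C * `|v| ].

Definition is_adjoint (T T' : H -> H) : Prop :=
  forall v w, ip (T v) w = ip v (T' w).

Definition commutant S : set (H -> H) :=
  [set T | bounded_operators T /\ forall s, S s -> T \o s = s \o T].

(* A self-adjoint set of operators that equals its bicommutant is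
   automatically a unital subalgebra. *)
Definition von_neumann_algebra A : Prop :=
  [/\ A `<=` bounded_operators,
      forall T, A T -> exists2 T', A T' & is_adjoint T T' &
      commutant (commutant A) = A].

Definition von_neumann_generated S : set (H -> H) :=
  \bigcap_(A in [set A | von_neumann_algebra A /\ S `<=` A]) A.

Definition operator_ball M : set (H -> H) :=
  [set x | M x /\ forall v, `|x v| <= `|v| ].

Definition square_summable (xi : nat -> H) : Prop :=
  exists B : R[i], forall n, \sum_(k < n) `|xi k| ^+ 2 <= B.

(* The predual of [M]: the restrictions to [M] of the functionals
   x |-> Tr(x t), with t a trace-class operator, that is, of the functionals
   x |-> sum_k <x xi_k, eta_k> with square-summable xi and eta. *)
Definition in_predual M (f : (H -> H) -> R[i]) : Prop :=
  exists xi eta : nat -> H,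
    [/\ square_summable xi, square_summable eta &
        forall x, M x ->
          (fun n => \sum_(k < n) ip (x (xi k)) (eta k) : R[i]^o) @ \oo --> (f x : R[i]^o)].

Definition separable_predual M : Prop :=
  exists phi : nat -> (H -> H) -> R[i],
    (forall k, in_predual M (phi k)) /\
    forall f, in_predual M f -> forall e : R[i], 0 < e ->
      exists k, forall x, operator_ball M x -> `|f x - phi k x| <= e.

Definition linear_on M (V : lmodType R[i]) (f : (H -> H) -> V) : Prop :=
  forall (a : R[i]) x y, M x -> M y -> f (a *: x + y) = a *: f x + f y.

Definition faithful_normal_state M psi : Prop :=
  [/\ linear_on M (psi : (H -> H) -> R[i]^o),
      psi id = 1,
      (forall x x', M x -> is_adjoint x x' -> 0 <= psi (x' \o x)),
      (forall x x', M x -> is_adjoint x x' -> psi (x' \o x) = 0 -> x = 0) &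
      in_predual M psi].

Definition probability_space M psi : Prop :=
  [/\ von_neumann_algebra M, separable_predual M &
      faithful_normal_state M psi].

(* The maps below are functions on all of [H -> H]; only their values on [M]
   are meaningful. *)

Definition conditional_expectation M psi N (E : (H -> H) -> (H -> H)) : Prop :=
  [/\ (forall x, M x -> N (E x)) /\ (forall x, N x -> E x = x),
      linear_on M E,
      (forall a x b, N a -> M x -> N b -> E (a \o x \o b) = a \o E x \o b),
      (forall x x', M x -> is_adjoint x x' ->
         forall v, 0 <= ip (E (x' \o x) v) v) &
      (forall x, M x -> psi (E x) = psi x)].

Definition conditioned_subalgebra M psi N : Prop :=
  [/\ von_neumann_algebra N, N `<=` M &
      exists E, conditional_expectation M psi N E].

(* The square with top row [N2] in [P] and bottom row [N] in [N1]. *)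
Definition commuting_square M psi N2 P N N1 : Prop :=
  [/\ [/\ conditioned_subalgebra M psi N2, conditioned_subalgebra M psi P,
          conditioned_subalgebra M psi N & conditioned_subalgebra M psi N1],
      [/\ N2 `<=` P, N `<=` N1, N `<=` N2 & N1 `<=` P] &
      exists E1 E2 E,
        [/\ conditional_expectation M psi N1 E1,
            conditional_expectation M psi N2 E2,
            conditional_expectation M psi N E &
            forall x, M x -> E1 (E2 x) = E x]].

Definition automorphism M psi (f : (H -> H) -> (H -> H)) : Prop :=
  [/\ set_bij M M f, linear_on M f,
      (forall x y, M x -> M y -> f (x \o y) = f x \o f y),
      (forall x x', M x -> is_adjoint x x' -> is_adjoint (f x) (f x')) &
      (forall x, M x -> psi (f x) = psi x)].

Fixpoint partial_product (alphas : nat -> (H -> H) -> (H -> H)) (n : nat) :=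
  if n is m.+1 then partial_product alphas m \o alphas m.+1 else id.

(* [alpha] is the limit of alphas_1 alphas_2 ... alphas_n in the pointwise
   strong operator topology, and the factors are adapted to the tower. *)
Definition adapted_with_product_representation M psi
    (tower : nat -> set (H -> H))
    (alpha : (H -> H) -> (H -> H))
    (alphas : nat -> (H -> H) -> (H -> H)) : Prop :=
  [/\ forall k, (1 <= k)%N -> automorphism M psi (alphas k),
      forall n k, (1 <= k <= n)%N -> alphas k @` tower n = tower n,
      forall n k, (n.+2 <= k)%N -> forall x, tower n x -> alphas k x = x &
      forall x, M x -> forall v,
        (fun n => partial_product alphas n x v) @ \oo --> alpha x v].

Definition braid_representation M psi
    (rho : braid_group -> (H -> H) -> (H -> H)) : Prop :=
  (forall g, automorphism M psi (rho g)) /\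
  (forall g h x, M x -> rho (g * h)%g x = rho g (rho h x)).

Definition fixed_points M (f : (H -> H) -> (H -> H)) : set (H -> H) :=
  [set x | M x /\ f x = x].

Definition fixed_points_of M (rho : braid_group -> (H -> H) -> (H -> H))
    (G : set braid_group) : set (H -> H) :=
  [set x | M x /\ forall g, G g -> rho g x = x].

Definition unitary_in M (u : H -> H) : Prop :=
  M u /\ exists2 u', is_adjoint u u' & u \o u' = id /\ u' \o u = id.

Definition is_Ad M (u : H -> H) (f : (H -> H) -> (H -> H)) : Prop :=
  forall u', is_adjoint u u' -> forall x, M x -> f x = u \o x \o u'.

End Operators.

(* [shifted_tower M_(-1) (M_n)_n m] is M_{m-1}. *)
Definition shifted_tower (T : Type) (Mm1 : set T) (tower : nat -> set T)
    (m : nat) : set T :=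
  if m is m'.+1 then tower m' else Mm1.

(* Main.v *)
Require Import Defs.
From HB Require Import structures.
From mathcomp Require Import all_boot all_order all_algebra.
From mathcomp Require Import all_classical all_reals all_analysis.
From mathcomp Require Import complex.
From mathcomp Require Import ring lra.

(** The inclusion of M_n in the fixed points is adaptedness, together with the
    remark that alpha and alpha_1 agree on M_0, so that M_(-1) is fixed by
    alpha_1.  The substance is the converse, and it is a Bessel argument in the
    inner product <x, y> = psi(y* x), for which automorphisms are isometries
    and conditional expectations are orthogonal projections.

    Write E_n for the expectation onto M_n and let x be fixed by alpha_k for
    all k >= n+2.  Put d = E_(n+1) x - E_n x, a vector of M_(n+1) orthogonal to
    M_n, and apply alpha_(n+2), alpha_(n+3), ... in succession.  Each of the
    commuting squares says that alpha_k carries a vector of M_(k-1) orthogonal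
    to M_(k-2) to one of M_k that is orthogonal to M_(k-1)
    ([square_orthogonal]).  Hence the images of d are pairwise orthogonal.
    They all have the norm of d, and since x is fixed by the automorphisms
    used, they all have with x the inner product <x, d> = <d, d>.  Infinitely
    many orthogonal vectors of the same length cannot have the same non-zero
    inner product with x, so d = 0 ([orthogonal_copies_null],
    [expectation_stationary]).  The same applies at every later level, whence
    E_N x = E_n x for all N >= n, and y = x - E_n x is orthogonal to the union A
    of the tower.

    It remains to see that an element y of M orthogonal to A vanishes.  This is
    the density of a unital self-adjoint algebra in the von Neumann algebra that
    it generates, tested on the normal functional psi ([normal_density]).  Such
    a functional is a vector functional on the amplification l2(H); the
    projection of l2(H) onto the closure of an A-invariant subspace has matrix
    entries in the commutant of A, and these commute with M
    ([generated_commutes]).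

    Finally, an element is fixed by rho(B_(n+2,infty)) as soon as it is fixed by
    the generators rho(sigma_k) = alpha_k, k >= n+2 ([fixed_by_generators]). *)

Set Implicit Arguments.
Unset Strict Implicit.
Unset Printing Implicit Defensive.

Import Order.TTheory GRing.Theory Num.Theory.
Import numFieldNormedType.Exports.
Local Open Scope classical_set_scope.
Local Open Scope ring_scope.
Local Open Scope complex_scope.

Local Notation Re := (@complex.Re _).

(** * Semi-inner products, orthogonal projections *)

Section RealLemmas.
Context {R : realType}.

Lemma quadratic_ge0 (a b c : R) :
  (forall t, 0 <= a - 2 * t * c + t ^+ 2 * b) -> 0 <= b -> c ^+ 2 <= a * b.
Proof.
move=> q b0; have [b_0|bn0] := eqVneq b 0.
  have [->|n0] := eqVneq c 0; first by rewrite expr0n b_0 mulr0.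
  (* At this t the value of the affine function is -1. *)
  have := q ((a + 1) / (2 * c)); rewrite b_0 mulr0 addr0.
  have -> : 2 * ((a + 1) / (2 * c)) * c = a + 1 by field.
  by lra.
have {}b0 : 0 < b by rewrite lt_neqAle eq_sym bn0.
(* The minimum of the quadratic is at t = c / b. *)
have := q (c / b).
have -> : a - 2 * (c / b) * c + (c / b) ^+ 2 * b = (a * b - c ^+ 2) / b.
  by field; exact: lt0r_neq0.
by rewrite ler_pdivlMr // mul0r subr_ge0.
Qed.

Lemma le0_small (x c : R) :
  0 <= c -> (forall e, 0 < e -> x <= c * e) -> x <= 0.
Proof.
move=> c0 h; rewrite leNgt; apply/negP => x0.
have d0 : 0 < 2 * (c + 1) by lra.
have := h (x / (2 * (c + 1))) (divr_gt0 x0 d0).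
rewrite mulrA ler_pdivlMr //; nra.
Qed.

Lemma inv_small (e : R) : 0 < e ->
  exists n, forall i, (n <= i)%N -> i.+1%:R^-1 <= e.
Proof.
move=> e0; exists (Num.bound e^-1) => i ni.
have ie0 : 0 <= e^-1 by rewrite invr_ge0 ltW.
rewrite -[leRHS]invrK lef_pV2 ?posrE ?invr_gt0 //.
apply: (le_trans (ltW (archi_boundP ie0))).
by rewrite ler_nat (leq_trans ni).
Qed.

End RealLemmas.

Section SemiInnerProduct.
Context {R : realType} {V : lmodType R[i]}.

Definition linear_subspace (D : set V) : Prop :=
  D 0 /\ forall (a : R[i]) u v, D u -> D v -> D (a *: u + v).

(** Only real parts of inner products are kept: on complex subspaces real and
    complex orthogonality agree.  Complex scalars still act, as operators with
    an adjoint.  The form lives on a domain [D], so that the same results serve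
    a von Neumann algebra with a state and the square-summable sequences. *)
Record semi_inner_product (D : set V) (L : V -> V -> R) : Prop := {
  sip_sub : linear_subspace D;
  sipC : forall u v, D u -> D v -> L u v = L v u;
  sipP : forall (t : R) u v w, D u -> D v -> D w ->
    L (t%:C *: u + v) w = t * L u w + L v w;
  sip_ge0 : forall u, D u -> 0 <= L u u }.

Lemma subspaceD D u v : linear_subspace D -> D u -> D v -> D (u + v).
Proof. by case=> _ h Du Dv; rewrite -[u]scale1r; exact: h. Qed.

Lemma subspaceZ D (a : R[i]) u : linear_subspace D -> D u -> D (a *: u).
Proof. by case=> D0 h Du; rewrite -[_ *: _]addr0; exact: h. Qed.

Lemma subspaceB D u v : linear_subspace D -> D u -> D v -> D (u - v).
Proof.
by case=> _ h Du Dv; rewrite addrC -scaleN1r; exact: h.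
Qed.

Lemma subspace_sum D (u : nat -> V) n :
  linear_subspace D -> (forall i, D (u i)) -> D (\sum_(i < n) u i).
Proof.
move=> sD Du; elim: n => [|n ih]; first by rewrite big_ord0; case: sD.
by rewrite big_ord_recr; exact: subspaceD.
Qed.

Definition sip_closure (D : set V) (L : V -> V -> R) (S : set V) : set V :=
  [set v | D v /\ forall e, 0 < e -> exists2 a, S a & L (v - a) (v - a) <= e].

Definition is_projection (D : set V) (L : V -> V -> R) (S : set V)
    (w v : V) : Prop :=
  sip_closure D L S v /\ forall b, S b -> L (w - v) b = 0.

Definition sip_complete (D : set V) (L : V -> V -> R) : Prop :=
  forall s : nat -> V, (forall i, D (s i)) ->
  (forall e, 0 < e -> exists n, forall i j, (n <= i)%N -> (n <= j)%N ->
     L (s i - s j) (s i - s j) <= e) ->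
  exists2 v, D v & forall e, 0 < e -> exists n, forall i, (n <= i)%N ->
     L (v - s i) (v - s i) <= e.

Section Form.
Context {D : set V} {L : V -> V -> R} (sL : semi_inner_product D L).
Let sD := sip_sub sL.

Lemma sipDl u v w : D u -> D v -> D w -> L (u + v) w = L u w + L v w.
Proof.
by move=> Du Dv Dw; rewrite -{1}[u]scale1r (sipP sL 1) // mul1r.
Qed.

Lemma sip0l w : D w -> L 0 w = 0.
Proof.
move=> Dw; have D0 := sD.1; have := sipDl D0 D0 Dw.
by rewrite addr0 => /eqP; rewrite -subr_eq subrr => /eqP.
Qed.

Lemma sipZl t u w : D u -> D w -> L (t%:C *: u) w = t * L u w.
Proof.
move=> Du Dw; rewrite -[_ *: _]addr0 (sipP sL) ?sip0l ?addr0 //.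
by case: sD.
Qed.

Lemma sipBl u v w : D u -> D v -> D w -> L (u - v) w = L u w - L v w.
Proof.
move=> Du Dv Dw; rewrite addrC -scaleN1r.
have -> : (-1 : R[i]) = (-1 : R)%:C by rewrite rmorphN rmorph1.
by rewrite (sipP sL) // mulN1r addrC.
Qed.

Lemma sipDr u v w : D u -> D v -> D w -> L w (u + v) = L w u + L w v.
Proof.
move=> Du Dv Dw; rewrite (sipC sL) ?sipDl ?(sipC sL _ Dw) //.
exact: (subspaceD sD).
Qed.

Lemma sipBr u v w : D u -> D v -> D w -> L w (u - v) = L w u - L w v.
Proof.
move=> Du Dv Dw; rewrite (sipC sL) ?sipBl ?(sipC sL _ Dw) //.
exact: (subspaceB sD).
Qed.

Lemma sipZr t u w : D u -> D w -> L w (t%:C *: u) = t * L w u.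
Proof.
move=> Du Dw; rewrite (sipC sL) ?sipZl ?(sipC sL _ Dw) //.
exact: (subspaceZ _ sD).
Qed.

Lemma sip0r w : D w -> L w 0 = 0.
Proof. by move=> Dw; rewrite (sipC sL) ?sip0l //; case: sD. Qed.

Lemma sip_sqrB u v : D u -> D v ->
  L (u - v) (u - v) = L u u - 2 * L u v + L v v.
Proof.
move=> Du Dv; have Duv := subspaceB sD Du Dv.
by rewrite sipBl // !sipBr // (sipC sL Dv Du); ring.
Qed.

Lemma sip_sqrD u v : D u -> D v ->
  L (u + v) (u + v) = L u u + 2 * L u v + L v v.
Proof.
move=> Du Dv; have Duv := subspaceD sD Du Dv.
by rewrite sipDl // !sipDr // (sipC sL Dv Du); ring.
Qed.

Lemma sip_sqrD_le u v : D u -> D v ->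
  L (u + v) (u + v) <= 2 * L u u + 2 * L v v.
Proof.
move=> Du Dv; have := sip_ge0 sL (subspaceB sD Du Dv).
by rewrite sip_sqrB // sip_sqrD //; lra.
Qed.

Lemma sip_sqrB_sym u v : D u -> D v ->
  L (u - v) (u - v) = L (v - u) (v - u).
Proof. by move=> Du Dv; rewrite !sip_sqrB // (sipC sL Du Dv); ring. Qed.

Lemma sip_cauchy_schwarz u v : D u -> D v ->
  L u v ^+ 2 <= L u u * L v v.
Proof.
move=> Du Dv.
apply: quadratic_ge0 (sip_ge0 sL Dv) => t.
have Dt := subspaceZ (t%:C) sD Dv.
have := sip_ge0 sL (subspaceB sD Du Dt).
by rewrite sip_sqrB // sipZr // sipZl // sipZr // => h; nra.
Qed.

(** By Bessel, n * c <= L x x for all n: subtract the sum of the first n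
    vectors from x. *)
Lemma orthogonal_copies_null (d : nat -> V) x c :
  (forall j, D (d j)) -> D x ->
  (forall i j, (i < j)%N -> L (d i) (d j) = 0) ->
  (forall j, L (d j) (d j) = c) -> (forall j, L x (d j) = c) -> c = 0.
Proof.
move=> Dd Dx orth sq inn.
pose y n := \sum_(i < n) d i.
have Dy n : D (y n) by exact: (subspace_sum _ sD).
have yS n : y n.+1 = y n + d n by rewrite /y big_ord_recr.
have yd n j : (n <= j)%N -> L (y n) (d j) = 0.
  elim: n => [|n ih] nj; first by rewrite /y big_ord0 sip0l.
  by rewrite yS sipDl // ih ?(ltnW nj) // orth // addr0.
have yy n : L (y n) (y n) = n%:R * c.
  elim: n => [|n ih]; first by rewrite /y big_ord0 mul0r sip0l //; case: sD.
  by rewrite yS sip_sqrD // ih yd // sq -[n.+1%:R]natr1; ring.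
have xy n : L x (y n) = n%:R * c.
  elim: n => [|n ih]; first by rewrite /y big_ord0 mul0r sip0r.
  by rewrite yS sipDr // ih inn -[n.+1%:R]natr1; ring.
have bnd n : n%:R * c <= L x x.
  have := sip_ge0 sL (subspaceB sD Dx (Dy n)).
  by rewrite sip_sqrB // xy yy; lra.
have c0 : 0 <= c by rewrite -(sq 0%N); exact: (sip_ge0 sL (Dd 0%N)).
apply/eqP; apply: contraT => cn0.
have {cn0} cp : 0 < c by rewrite lt_neqAle eq_sym cn0.
have := bnd (Num.bound (L x x / c)).
have := archi_boundP (divr_ge0 (sip_ge0 sL Dx) (ltW cp)).
rewrite ltr_pdivrMr // => h1 h2.
by have := lt_le_trans h1 h2; rewrite ltxx.
Qed.

Section Projection.
Context {S : set V} (sS : linear_subspace S) (SD : S `<=` D).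

(** A minimizing sequence of distances from w to S is Cauchy by the
    parallelogram law, and the gradient of the distance vanishes at its
    limit. *)
Lemma projection_exists w : sip_complete D L -> D w ->
  exists v, is_projection D L S w v.
Proof.
move=> cD Dw; pose E := [set L (w - a) (w - a) | a in S].
have lbE : lbound E 0.
  by move=> _ [a Sa <-]; apply: (sip_ge0 sL); exact: (subspaceB sD Dw (SD Sa)).
have infE : has_inf E.
  by split; [exists (L (w - 0) (w - 0)); exists 0 => //; case: sS | exists 0].
pose dd := inf E.
have dle a : S a -> dd <= L (w - a) (w - a).
  by move=> Sa; apply: ge_inf; [exists 0 | exists a].
have /choice[s sP] : forall i : nat, exists a,
    S a /\ L (w - a) (w - a) <= dd + i.+1%:R^-1.
  move=> i; have i0 : 0 < i.+1%:R^-1 :> R by rewrite invr_gt0.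
  have [_ [a Sa <-] lt] := inf_adherent i0 infE.
  by exists a; split=> //; exact: ltW.
have Ss i : S (s i) by case: (sP i).
have Ds i : D (s i) by exact: SD.
have Dws i : D (w - s i) by exact: (subspaceB sD).
have near i j : L (s i - s j) (s i - s j) <= 2 * i.+1%:R^-1 + 2 * j.+1%:R^-1.
  have [_ hi] := sP i; have [_ hj] := sP j.
  (* The midpoint of two almost minimal points is no closer to w. *)
  have Sm : S ((2^-1 : R)%:C *: (s i + s j)).
    by apply: (subspaceZ _ sS); exact: (subspaceD sS).
  have Dij := subspaceD sD (Ds i) (Ds j); have Dm := SD Sm.
  have := dle _ Sm.
  rewrite [L (w - _) _]sip_sqrB // sipZr // sipZl // sipZr //.
  rewrite sip_sqrD // sipDr //.
  move: hi hj; rewrite !sip_sqrB //.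
  by move: (i.+1%:R^-1) (j.+1%:R^-1) => x y; lra.
have [|v Dv lim] := cD s Ds.
  move=> e e0; have e4 : 0 < e / 4 by lra.
  have [n nP] := inv_small e4; exists n => i j ni nj.
  have := near i j; have := nP i ni; have := nP j nj.
  by move: (i.+1%:R^-1) (j.+1%:R^-1) => x y; lra.
exists v; split.
  split=> // e e0; have [n nP] := lim e e0.
  by exists (s n) => //; exact: nP.
move=> b Sb; have Db := SD Sb; have Dwv := subspaceB sD Dw Dv.
apply/eqP; rewrite -sqrf_eq0 eq_le sqr_ge0 andbT.
have bb := sip_ge0 sL Db.
apply: (@le0_small _ _ (4 * L b b)) => [|e e0]; first lra.
have [n nP] := lim e e0; have [m mP] := inv_small e0.
pose i := maxn n m; have hv := nP i (leq_maxl _ _).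
have he := mP i (leq_maxr _ _).
(* Moving s i along b does not bring it closer than dd, which s i itself
   attains up to 1/(i+1): so w - s i is almost orthogonal to b. *)
have q : L (w - s i) b ^+ 2 <= i.+1%:R^-1 * L b b.
  apply: quadratic_ge0 bb => t.
  have Sst : S (s i + t%:C *: b).
    by apply: (subspaceD sS) => //; exact: (subspaceZ _ sS).
  have Dt : D (t%:C *: b) by exact: (subspaceZ _ sD).
  have := dle _ Sst; rewrite opprD addrA sip_sqrB // sipZr // sipZl // sipZr //.
  have [_] := sP i.
  by move: (i.+1%:R^-1) => x; lra.
have Dvs : D (v - s i) by exact: (subspaceB sD).
have r := sip_cauchy_schwarz Dvs Db.
have -> : L (w - v) b = L (w - s i) b - L (v - s i) b.
  by rewrite !sipBl //; ring.
have {}q := le_trans q (ler_wpM2r bb he).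
have {}r := le_trans r (ler_wpM2r bb hv).
move: (L (w - s i) b) (L (v - s i) b) q r => x y q r.
by have := sqr_ge0 (x + y); rewrite sqrrB sqrrD; lra.
Qed.

Lemma sip_closure_orthogonal u v : D u -> (forall b, S b -> L u b = 0) ->
  sip_closure D L S v -> L u v = 0.
Proof.
move=> Du orth [Dv near]; apply/eqP; rewrite -sqrf_eq0 eq_le sqr_ge0 andbT.
apply: (@le0_small _ _ (L u u)) => [|e e0]; first exact: (sip_ge0 sL).
have [a Sa ae] := near e e0; have Da := SD Sa.
have Dva := subspaceB sD Dv Da.
have -> : L u v = L u (v - a) by rewrite sipBr // (orth a) // subr0.
apply: (le_trans (sip_cauchy_schwarz Du Dva)).
by rewrite ler_wpM2l //; exact: (sip_ge0 sL).
Qed.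

Lemma sip_closureB u v : sip_closure D L S u -> sip_closure D L S v ->
  sip_closure D L S (u - v).
Proof.
move=> [Du uP] [Dv vP]; split=> [|e e0]; first exact: (subspaceB sD).
have e4 : 0 < e / 4 by lra.
have [a Sa ae] := uP _ e4; have [b Sb be] := vP _ e4.
exists (a - b); first exact: (subspaceB sS).
have Da := SD Sa; have Db := SD Sb.
have Dua := subspaceB sD Du Da; have Dvb := subspaceB sD Dv Db.
have -> : u - v - (a - b) = (u - a) - (v - b).
  by rewrite !opprD !opprK addrACA.
have := sip_sqrD_le Dua (subspaceB sD Db Dv).
by rewrite (sip_sqrB_sym Db Dv) opprB; lra.
Qed.

(** The difference of two projections lies in the closure of S and is
    orthogonal to S. *)
Lemma projection_unique w v v' :
  (forall u, D u -> L u u = 0 -> u = 0) -> D w ->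
  is_projection D L S w v -> is_projection D L S w v' -> v = v'.
Proof.
move=> def Dw [cv ov] [cv' ov']; have Dv := cv.1; have Dv' := cv'.1.
have Dvv := subspaceB sD Dv Dv'.
apply/eqP; rewrite -subr_eq0; apply/eqP/def => //.
apply: sip_closure_orthogonal (sip_closureB cv cv') => // b Sb.
have -> : v - v' = (w - v') - (w - v) by rewrite opprB [RHS]addrC addrA subrK.
have Db := SD Sb; have D1 := subspaceB sD Dw Dv.
have D2 := subspaceB sD Dw Dv'.
by rewrite sipBl // ov // ov' // subrr.
Qed.

Lemma projection_of_self a : S a -> is_projection D L S a a.
Proof.
move=> Sa; have Da := SD Sa; split=> [|b Sb].
  split=> // e e0; exists a => //.
  by rewrite subrr sip0l ?(ltW e0) //; case: sD.
by rewrite subrr sip0l //; exact: SD.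
Qed.

Lemma projection_of_orthogonal u : D u -> (forall b, S b -> L u b = 0) ->
  is_projection D L S u 0.
Proof.
move=> Du orth; split=> [|b Sb]; last by rewrite subr0 orth.
by case: (projection_of_self sS.1).
Qed.

Lemma projection_sym u u' v v' : D u -> D v ->
  is_projection D L S u u' -> is_projection D L S v v' -> L u' v = L u v'.
Proof.
move=> Du Dv [cu ou] [cv ov]; have Du' := cu.1; have Dv' := cv.1.
have := sip_closure_orthogonal (subspaceB sD Du Du') ou cv.
have := sip_closure_orthogonal (subspaceB sD Dv Dv') ov cu.
by rewrite !sipBl // (sipC sL Dv Du') (sipC sL Dv' Du'); lra.
Qed.

Lemma projection_contraction u u' : D u -> is_projection D L S u u' ->
  L u' u' <= L u u.
Proof.
move=> Du [cu ou]; have Du' := cu.1.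
have := sip_closure_orthogonal (subspaceB sD Du Du') ou cu.
rewrite sipBl // => e; have := sip_ge0 sL (subspaceB sD Du Du').
by rewrite sip_sqrB //; lra.
Qed.

Lemma projectionD u u' v v' : D u -> D v ->
  is_projection D L S u u' -> is_projection D L S v v' ->
  is_projection D L S (u + v) (u' + v').
Proof.
move=> Du Dv [cu ou] [cv ov]; have Du' := cu.1; have Dv' := cv.1.
have cN : sip_closure D L S (0 - v').
  by apply: sip_closureB cv; case: (projection_of_self sS.1).
split=> [|b Sb].
  by have := sip_closureB cu cN; rewrite sub0r opprK.
have Db := SD Sb; have D1 := subspaceB sD Du Du'.
have D2 := subspaceB sD Dv Dv'.
have -> : u + v - (u' + v') = (u - u') + (v - v') by rewrite opprD addrACA.
by rewrite sipDl // ou // ov // addr0.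
Qed.

(** An operator that leaves S invariant together with its adjoint leaves both
    the closure of S and its orthogonal complement invariant, hence commutes
    with the projection. *)
Lemma projection_morph (t t' : V -> V) (c : R) u u' :
  (forall x, D x -> D (t x)) -> (forall x, D x -> D (t' x)) ->
  (forall x y, D x -> D y -> t (x - y) = t x - t y) ->
  (forall x y, D x -> D y -> L (t x) y = L x (t' y)) ->
  (forall x, D x -> L (t x) (t x) <= c * L x x) -> 0 <= c ->
  (forall x, S x -> S (t x)) -> (forall x, S x -> S (t' x)) ->
  D u -> is_projection D L S u u' -> is_projection D L S (t u) (t u').
Proof.
move=> Dt Dt' tB adj bnd c0 St St' Du [[Du' cu] ou]; split.
  split=> [|e e0]; first exact: Dt.
  have e1 : 0 < e / (c + 1) by apply: divr_gt0 => //; lra.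
  have [a Sa ae] := cu _ e1; have Da := SD Sa.
  exists (t a); first exact: St.
  have Dua := subspaceB sD Du' Da.
  rewrite -tB //; apply: (le_trans (bnd _ Dua)).
  move: ae; rewrite ler_pdivlMr; last lra.
  by have := sip_ge0 sL Dua; lra.
move=> b Sb; have Db := SD Sb; have D1 := subspaceB sD Du Du'.
by rewrite -tB // adj // ou //; exact: St'.
Qed.

End Projection.
End Form.

End SemiInnerProduct.
(** * The real inner product and square-summable sequences *)

Section RealInnerProduct.
Context {R : realType} {H : completeNormedModType R[i]}.
Context (ip : {dot H for Num.conj}).

Definition real_ip (v w : H) : R := Re (ip v w).

Lemma Re_realM (t : R) (z : R[i]) : Re (t%:C * z) = t * Re z.
Proof. by case: z => a b /=; rewrite mul0r subr0. Qed.

Lemma ReD (y z : R[i]) : Re (y + z) = Re y + Re z.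
Proof. by case: y z => [a b] [c d]. Qed.

Lemma ReB (y z : R[i]) : Re (y - z) = Re y - Re z.
Proof. by case: y z => [a b] [c d]. Qed.

Lemma Re_sum n (F : 'I_n -> R[i]) :
  Re (\sum_(k < n) F k) = \sum_(k < n) Re (F k).
Proof. exact: (big_morph Re ReD). Qed.

Lemma ge0_ReE (z : R[i]) : 0 <= z -> z = (Re z)%:C.
Proof. by case: z => a b; rewrite lecE /= => /andP[/eqP -> _]. Qed.

Lemma Re_ge0 (z : R[i]) : 0 <= z -> 0 <= Re z.
Proof. by rewrite lecE => /andP[]. Qed.

Lemma ipC v w : ip v w = (ip w v)^*.
Proof. by rewrite hermC expr0 mul1r. Qed.

Lemma ip_ge0 v : 0 <= ip v v.
Proof.
have [->|v0] := eqVneq v 0; first by rewrite linear0r.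
exact/ltW/neq0_dnorm_gt0.
Qed.

Lemma ip_eq0 v : ip v v = 0 -> v = 0.
Proof.
move=> v0; apply/eqP; apply: contraT => /(neq0_dnorm_gt0 (s := ip)).
by rewrite v0 ltxx.
Qed.

Lemma real_ipZl (c : R[i]) v w : real_ip (c *: v) w = real_ip v (c^* *: w).
Proof. by rewrite /real_ip linearZl_LR linearZr_LR /= -{1}[c](@conjcK R). Qed.

Lemma real_ip_sip : semi_inner_product setT real_ip.
Proof.
split=> //.
- by move=> u v _ _; rewrite /real_ip ipC; case: (ip v u).
- move=> t u v w _ _ _; rewrite /real_ip linearDl linearZl_LR /=.
  by rewrite ReD Re_realM.
- by move=> u _; exact/Re_ge0/ip_ge0.
Qed.

Lemma real_ip_eq0 v : real_ip v v = 0 -> v = 0.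
Proof.
move=> v0; apply: ip_eq0; rewrite (ge0_ReE (ip_ge0 v)).
by rewrite -[Re _]/(real_ip v v) v0.
Qed.

Lemma ip_real_ip v w : ip v w = real_ip v w +i* real_ip v ('i *: w).
Proof.
rewrite /real_ip linearZr_LR /=; case: (ip v w) => a b /=.
by rewrite !(mul0r, mulN1r, mul1r, sub0r, opprK).
Qed.

(** Testing against 'i *: w recovers the imaginary parts. *)
Lemma adjoint_of_real (T T' : H -> H) : linear T' ->
  (forall v w, real_ip (T v) w = real_ip v (T' w)) -> is_adjoint ip T T'.
Proof.
move=> linT' h v w; rewrite !ip_real_ip !h.
suff -> : T' ('i *: w) = 'i *: T' w by [].
by have := linT' 'i w 0; rewrite !addr0 => ->; have := linT' 1 0 0;
  rewrite scale1r addr0 scale1r => /eqP; rewrite -subr_eq subrr => /eqP <-;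
  rewrite addr0.
Qed.

Lemma real_adjoint (T T' : H -> H) : is_adjoint ip T T' ->
  forall v w, real_ip (T v) w = real_ip v (T' w).
Proof. by move=> h v w; rewrite /real_ip h. Qed.

Lemma real_ip_sym v w : real_ip v w = real_ip w v.
Proof. exact: (sipC real_ip_sip). Qed.

Lemma real_ip0l w : real_ip 0 w = 0.
Proof. exact: (sip0l real_ip_sip). Qed.

Lemma real_ip_ge0 v : 0 <= real_ip v v.
Proof. exact: (sip_ge0 real_ip_sip). Qed.

Context (hip : hilbert_norm ip).

Lemma norm_sqr_real_ip v : `|v| ^+ 2 = (real_ip v v)%:C.
Proof. by rewrite hip (ge0_ReE (ip_ge0 v)). Qed.

Lemma norm_le_real_ip v (e : R) : 0 <= e ->
  (`|v| <= e%:C) = (real_ip v v <= e ^+ 2).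
Proof.
move=> e0; rewrite -lecR -norm_sqr_real_ip rmorphXn /=.
by rewrite ler_pXn2r ?nnegrE ?normr_ge0 ?ler0c.
Qed.

Lemma bounded_real_ip (T : H -> H) : bounded_operators T ->
  exists2 c : R, 0 <= c & forall v, real_ip (T v) (T v) <= c * real_ip v v.
Proof.
case=> linT [C hC]; exists (Re C ^+ 2); first exact: sqr_ge0.
move=> v; have := hC v; set x := `|v| => h.
have [v0|v0] := eqVneq v 0.
  move: h; rewrite /x v0 normr0 mulr0 normr_le0 => /eqP ->.
  by rewrite real_ip0l mulr0.
have x0 : 0 < x by rewrite normr_gt0.
have C0 : 0 <= C.
  by have := le_trans (normr_ge0 _) h; rewrite pmulr_lge0.
have h2 : `|T v| ^+ 2 <= (C * x) ^+ 2.
  by rewrite ler_pXn2r ?nnegrE ?normr_ge0 ?mulr_ge0 // ltW.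
move: h2; rewrite exprMn !norm_sqr_real_ip (ge0_ReE C0) -rmorphXn -rmorphM.
by rewrite lecR /=.
Qed.

Lemma contraction_bounded (T : H -> H) : linear T ->
  (forall v, real_ip (T v) (T v) <= real_ip v v) -> bounded_operators T.
Proof.
move=> linT h; split=> //; exists 1 => v; rewrite mul1r.
by rewrite -(ler_pXn2r (ltn0Sn 1)) ?nnegrE ?normr_ge0 // !norm_sqr_real_ip lecR.
Qed.

Lemma real_ip_complete : sip_complete setT real_ip.
Proof.
move=> s _ cau.
have /cauchy_cvgP cs : cauchy (s @ \oo).
  apply: cauchy_exP => e e0.
  have eE := ge0_ReE (ltW e0); have r0 : 0 < Re e by rewrite -ltcR -eE.
  have r2 : 0 < (Re e / 2) ^+ 2 by rewrite exprn_gt0 // divr_gt0.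
  have [n nP] := cau _ r2; exists (s n); exists n => // i /= ni.
  rewrite -ball_normE /= eE.
  apply: (@le_lt_trans _ _ (Re e / 2)%:C).
    by rewrite norm_le_real_ip ?nP // divr_ge0 // ltW.
  by rewrite ltcR; lra.
exists (lim (s @ \oo)) => // e e0.
have q0 : 0 < (Num.sqrt e)%:C :> R[i] by rewrite ltcR sqrtr_gt0.
have /cvgrPdist_le/(_ _ q0)[n _ nP] := cs; exists n => i ni.
have := nP i ni; rewrite norm_le_real_ip ?sqrtr_ge0 // sqr_sqrtr //.
exact: ltW.
Qed.

End RealInnerProduct.

Section SquareSummable.
Context {R : realType} {H : completeNormedModType R[i]}.
Context (ip : {dot H for Num.conj}).

(** The partial sums are semi-inner products on all sequences; working with
    them keeps convergence out of the algebraic identities. *)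
Definition partial_ip (n : nat) (u v : nat -> H) : R :=
  \sum_(k < n) real_ip ip (u k) (v k).

Definition ell2 : set (nat -> H) :=
  [set u | exists B, forall n, partial_ip n u u <= B].

Definition ell2_ip (u v : nat -> H) : R := limn (fun n => partial_ip n u v).

Lemma partial_ip_sip n : semi_inner_product setT (partial_ip n).
Proof.
have s := real_ip_sip ip; split=> //.
- by move=> u v _ _; apply: eq_bigr => k _; exact: real_ip_sym.
- move=> t u v w _ _ _; rewrite /partial_ip mulr_sumr -big_split /=.
  by apply: eq_bigr => k _; rewrite (sipP s).
- by move=> u _; apply: sumr_ge0 => k _; exact: real_ip_ge0.
Qed.

Lemma partial_ip_le u m n : (m <= n)%N -> partial_ip m u u <= partial_ip n u u.
Proof.
move=> mn; rewrite /partial_ip -(subnKC mn) big_split_ord /= lerDl.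
by apply: sumr_ge0 => k _; exact: real_ip_ge0.
Qed.

Lemma ell2_cvg_sqr u : ell2 u -> cvgn (fun n => partial_ip n u u).
Proof.
case=> B uB; apply: nondecreasing_is_cvgn.
  by move=> m n mn; exact: partial_ip_le.
by exists B => _ [n _ <-].
Qed.

Lemma ell2_le u B : (forall n, partial_ip n u u <= B) -> ell2_ip u u <= B.
Proof.
move=> uB; apply: limr_le; first by apply: ell2_cvg_sqr; exists B.
by apply: nearW.
Qed.

Lemma partial_ip_le_ell2 u n : ell2 u -> partial_ip n u u <= ell2_ip u u.
Proof.
move=> eu; apply: nondecreasing_cvgn_le; last exact: ell2_cvg_sqr.
by move=> i j ij; exact: partial_ip_le.
Qed.

Lemma ell2D u v : ell2 u -> ell2 v -> ell2 (u + v).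
Proof.
move=> -[B uB] [C vC]; exists (2 * B + 2 * C) => n.
apply: (le_trans (@sip_sqrD_le _ _ _ _ (partial_ip_sip n) u v _ _)) => //.
by have := uB n; have := vC n; lra.
Qed.

Lemma ell2Z (c : R[i]) u : ell2 u -> ell2 (c *: u).
Proof.
move=> [B uB]; exists (Re (c^* * c) * B) => n.
have cc : c^* * c = (Re (c^* * c))%:C.
  by apply: ge0_ReE; rewrite mulrC mulcJ_ge0.
rewrite [partial_ip _ _ _](_ : _ = Re (c^* * c) * partial_ip n u u).
  apply: ler_wpM2l => //; apply: Re_ge0; rewrite mulrC; exact: mulcJ_ge0.
rewrite /partial_ip mulr_sumr; apply: eq_bigr => k _.
rewrite real_ipZl scalerA cc real_ip_sym (sipZl (real_ip_sip ip)) //.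
Qed.

Lemma ell2_subspace : linear_subspace ell2.
Proof.
split=> [|a u v eu ev]; last by apply: ell2D => //; exact: ell2Z.
by exists 0 => n; rewrite /partial_ip big1 // => k _; exact: real_ip0l.
Qed.

(** By polarization, from the convergence of the monotone sums of squares. *)
Lemma ell2_cvg u v : ell2 u -> ell2 v -> cvgn (fun n => partial_ip n u v).
Proof.
move=> eu ev.
rewrite (_ : (fun n => _) = (fun n => 2^-1 *
  (partial_ip n (u + v) (u + v) - (partial_ip n u u + partial_ip n v v)))).
  apply: is_cvgM; first exact: is_cvg_cst.
  have h := ell2_cvg_sqr.
  exact: is_cvgB (h _ (ell2D eu ev)) (is_cvgD (h _ eu) (h _ ev)).
by apply/funext => n; rewrite (sip_sqrD (partial_ip_sip n)) //; field.
Qed.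

Lemma ell2_ip_ext u v u' v' :
  (forall n, partial_ip n u v = partial_ip n u' v') ->
  ell2_ip u v = ell2_ip u' v'.
Proof. by move=> h; rewrite /ell2_ip; under eq_fun do rewrite h. Qed.

Lemma ell2_sip : semi_inner_product ell2 ell2_ip.
Proof.
split.
- exact: ell2_subspace.
- move=> u v eu ev; apply: ell2_ip_ext => n.
  exact: (sipC (partial_ip_sip n)).
- move=> t u v w eu ev ew; apply: cvg_lim => //.
  rewrite [X in X @ _](_ : _ =
      fun n => t * partial_ip n u w + partial_ip n v w).
    apply: cvgD; last exact: ell2_cvg.
    by apply: cvgM; [exact: cvg_cst | exact: ell2_cvg].
  by apply/funext => n; rewrite (sipP (partial_ip_sip n)).
- move=> u eu; apply: limr_ge; first exact: ell2_cvg.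
  by apply: nearW => n; exact: (sip_ge0 (partial_ip_sip n)).
Qed.

Lemma ell2_coord_le u k : ell2 u -> real_ip ip (u k) (u k) <= ell2_ip u u.
Proof.
move=> eu; apply: le_trans (partial_ip_le_ell2 k.+1 eu).
rewrite /partial_ip big_ord_recr /= lerDr.
by apply: sumr_ge0 => i _; exact: real_ip_ge0.
Qed.

Lemma ell2_eq0 u : ell2 u -> ell2_ip u u = 0 -> u = 0.
Proof.
move=> eu u0; apply/funext => k; apply: (real_ip_eq0 (ip := ip)).
by apply/eqP; rewrite eq_le real_ip_ge0 -u0 ell2_coord_le.
Qed.

Definition single (j : nat) (h : H) : nat -> H :=
  fun k => if k == j then h else 0.

Lemma partial_ip_single j h u n : (j < n)%N ->
  partial_ip n (single j h) u = real_ip ip h (u j).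
Proof.
move=> jn; rewrite /partial_ip (bigD1 (Ordinal jn)) //= /single eqxx.
rewrite big1 ?addr0 // => k kj; rewrite ifF ?real_ip0l //.
by apply: contra_neqF kj => /eqP e; exact: val_inj.
Qed.

Lemma ell2_single j h : ell2 (single j h).
Proof.
exists (real_ip ip h h) => n.
apply: (le_trans (partial_ip_le _ (leq_maxl n j.+1))).
by rewrite partial_ip_single ?leq_maxr // /single eqxx.
Qed.

Lemma ell2_ip_single j h u : ell2_ip (single j h) u = real_ip ip h (u j).
Proof.
apply: cvg_lim => //; apply: cvg_near_cst.
by exists j.+1 => // n /= jn; exact: partial_ip_single.
Qed.

Lemma ell2_amplification (T : H -> H) (c : R) : 0 <= c ->
  (forall v, real_ip ip (T v) (T v) <= c * real_ip ip v v) ->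
  forall u, ell2 u ->
    ell2 (T \o u) /\ ell2_ip (T \o u) (T \o u) <= c * ell2_ip u u.
Proof.
move=> c0 hT u eu.
have h n : partial_ip n (T \o u) (T \o u) <= c * ell2_ip u u.
  apply: (@le_trans _ _ (c * partial_ip n u u)).
    by rewrite /partial_ip mulr_sumr; apply: ler_sum => k _; exact: hT.
  by apply: ler_wpM2l => //; exact: partial_ip_le_ell2.
by split; [exists (c * ell2_ip u u) | exact: ell2_le].
Qed.

Lemma ell2_amplification_adjoint (T T' : H -> H) u v : is_adjoint ip T T' ->
  ell2_ip (T \o u) v = ell2_ip u (T' \o v).
Proof.
move=> /real_adjoint adj; apply: ell2_ip_ext => n.
by apply: eq_bigr => k _; exact: adj.
Qed.

Context (hip : hilbert_norm ip).

Lemma square_summable_ell2 u : square_summable u -> ell2 u.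
Proof.
case=> B uB; exists (Re B) => n.
have := uB n; rewrite lecE => /andP[_]; rewrite Re_sum.
rewrite (eq_bigr (fun k : 'I_n => real_ip ip (u k) (u k))) // => k _.
by rewrite (norm_sqr_real_ip hip).
Qed.

(** Each coordinate converges because H is complete.  The Cauchy bound in l2
    bounds every partial sum, so it passes to the coordinatewise limit before
    the number of terms tends to infinity. *)
Lemma ell2_complete : sip_complete ell2 ell2_ip.
Proof.
move=> s es cau.
have sB i j : ell2 (s i - s j) by exact: (subspaceB ell2_subspace).
have /choice[v vP] : forall k, exists v, forall e, 0 < e -> exists n,
    forall i, (n <= i)%N -> real_ip ip (v - s i k) (v - s i k) <= e.
  move=> k; have [||v _ vP] := real_ip_complete hip (s := fun i => s i k) => //.
    move=> e e0; have [n nP] := cau e e0; exists n => i j ni nj.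
    exact: le_trans (ell2_coord_le k (sB i j)) (nP i j ni nj).
  by exists v.
have near m : forall e, 0 < e -> exists n, forall i, (n <= i)%N ->
    partial_ip m (v - s i) (v - s i) <= e.
  elim: m => [|m ih] e e0.
    by exists 0%N => i _; rewrite /partial_ip big_ord0 ltW.
  have e2 : 0 < e / 2 by lra.
  have [n1 h1] := ih _ e2; have [n2 h2] := vP m _ e2.
  exists (maxn n1 n2) => i; rewrite geq_max => /andP[i1 i2].
  rewrite /partial_ip big_ord_recr /=.
  by apply: (le_trans (lerD (h1 i i1) (h2 i i2))); lra.
have unif e : 0 < e -> exists n, forall i, (n <= i)%N -> forall m,
    partial_ip m (v - s i) (v - s i) <= e.
  move=> e0; have e4 : 0 < e / 4 by lra.
  have [n nP] := cau _ e4; exists n => i ni m.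
  have [n' n'P] := near m _ e4; pose j := maxn n n'.
  have h1 := n'P j (leq_maxr _ _); have h2 := nP j i (leq_maxl _ _) ni.
  have h3 := partial_ip_le_ell2 m (sB j i).
  (* The index j depends on the number m of terms; the bound does not. *)
  have -> : v - s i = (v - s j) + (s j - s i) by rewrite addrA subrK.
  apply: (le_trans (@sip_sqrD_le _ _ _ _ (partial_ip_sip m) _ _ _ _)) => //.
  lra.
have ev : ell2 v.
  have [n nP] := unif 1 ltr01; rewrite -(subrK (s n) v).
  by apply: ell2D => //; exists 1 => m; exact: nP.
exists v => // e e0; have [n nP] := unif e e0; exists n => i ni.
by apply: ell2_le => m; exact: nP.
Qed.

End SquareSummable.
(** * Commutants and ultraweak density *)

Section Commutants.
Context {R : realType} {H : completeNormedModType R[i]}.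
Implicit Types (S X A M : set (H -> H)) (T : H -> H).

Lemma bounded_id : bounded_operators (R := R) (@id H).
Proof. by split=> //; exists 1 => v; rewrite mul1r. Qed.

Lemma bounded0 T : bounded_operators T -> T 0 = 0.
Proof.
case=> linT _; have := linT (-1) 0 0.
by rewrite scaler0 addr0 scaleN1r addNr.
Qed.

Lemma bounded_linear T (c : R[i]) u v : bounded_operators T ->
  T (c *: u + v) = c *: T u + T v.
Proof. by move=> [linT _]; exact: linT. Qed.

Lemma boundedB T u v : bounded_operators T -> T (u - v) = T u - T v.
Proof.
move=> bT; rewrite addrC -scaleN1r bounded_linear //.
by rewrite scaleN1r addrC.
Qed.

Lemma bounded_const_ge0 T (C : R[i]) (v : H) : v != 0 ->
  (forall w, `|T w| <= C * `|w|) -> 0 <= C.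
Proof.
move=> v0 h; have := le_trans (normr_ge0 _) (h v).
by rewrite pmulr_lge0 // normr_gt0.
Qed.

Lemma bounded_comp T T' : bounded_operators T -> bounded_operators T' ->
  bounded_operators (T \o T').
Proof.
move=> bT bT'; have [lT [C hC]] := bT; have [lT' [C' hC']] := bT'.
split=> [c u v|]; first by rewrite /= !bounded_linear.
exists (C * C') => v /=; have [->|v0] := eqVneq v 0.
  by rewrite !bounded0 // normr0 mulr0.
apply: le_trans (hC _) _; rewrite -mulrA ler_wpM2l //.
exact: bounded_const_ge0 v0 hC.
Qed.

Lemma bounded_comb T T' (c : R[i]) : bounded_operators T ->
  bounded_operators T' -> bounded_operators (c *: T + T').
Proof.
move=> bT bT'; have [lT [C hC]] := bT; have [lT' [C' hC']] := bT'.
split=> [a u v|].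
  rewrite -[LHS]/(c *: T (a *: u + v) + T' (a *: u + v)).
  rewrite -[RHS]/(a *: (c *: T u + T' u) + (c *: T v + T' v)).
  rewrite (bounded_linear _ _ _ bT) (bounded_linear _ _ _ bT').
  by rewrite !scalerDr !scalerA [a * c]mulrC addrACA.
exists (`|c| * C + C') => v; rewrite -[X in `|X|]/(c *: T v + T' v).
apply: le_trans (ler_normD _ _) _.
by rewrite mulrDl lerD // normrZ -mulrA ler_wpM2l.
Qed.

Lemma commutant_bounded S : commutant S `<=` bounded_operators (R := R).
Proof. by move=> T []. Qed.

Lemma commutantS S X : S `<=` X -> commutant X `<=` commutant (R := R) S.
Proof. by move=> sX T [bT cT]; split=> // s /sX; exact: cT. Qed.

Lemma sub_bicommutant S : S `<=` bounded_operators (R := R) ->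
  S `<=` commutant (commutant S).
Proof.
by move=> bS T ST; split; [exact: bS | move=> s [_ cs]; rewrite cs].
Qed.

Lemma commutant_tricommutant S : S `<=` bounded_operators (R := R) ->
  commutant (commutant (commutant S)) = commutant S.
Proof.
move=> bS; apply/seteqP; split; first exact/commutantS/sub_bicommutant.
exact/sub_bicommutant/commutant_bounded.
Qed.

Definition unital_algebra A : Prop :=
  [/\ A `<=` bounded_operators (R := R), A id, linear_subspace A &
      forall T T', A T -> A T' -> A (T \o T')].

Lemma commutant_algebra S : S `<=` bounded_operators (R := R) ->
  unital_algebra (commutant S).
Proof.
move=> bS; split=> //; first exact: commutant_bounded.
- by split=> //; exact: bounded_id.
- split.
    split=> [|s Ss]; last first.
      by apply/funext => v /=; rewrite bounded0 //; exact: bS.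
    split=> [c u v|]; first by rewrite -[LHS]/0 scaler0 addr0.
    by exists 0 => v; rewrite -[X in `|X|]/0 normr0 mul0r.
  move=> c T T' [bT cT] [bT' cT']; split; first exact: bounded_comb.
  move=> s Ss; apply/funext => v.
  rewrite -[LHS]/(c *: (T \o s) v + (T' \o s) v) cT // cT' //=.
  by rewrite -bounded_linear //; exact: bS.
- move=> T T' [bT cT] [bT' cT']; split; first exact: bounded_comp.
  by move=> s Ss; rewrite -compA cT' // compA cT.
Qed.

Context (ip : {dot H for Num.conj}).

Definition self_adjoint_set A : Prop :=
  forall T, A T -> exists2 T', A T' & is_adjoint ip T T'.

Lemma von_neumann_unital A : von_neumann_algebra ip A -> unital_algebra A.
Proof. by case=> _ _ <-; exact/commutant_algebra/commutant_bounded. Qed.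

Lemma is_adjoint_sym T T' : is_adjoint ip T T' -> is_adjoint ip T' T.
Proof. by move=> adj v w; rewrite ipC -adj -ipC. Qed.

Lemma is_adjoint_unique T T1 T2 :
  is_adjoint ip T T1 -> is_adjoint ip T T2 -> T1 = T2.
Proof.
move=> a1 a2; apply/funext => w; apply/eqP; rewrite -subr_eq0; apply/eqP.
by apply: (@ip_eq0 _ _ ip); rewrite linearBr /= -a1 -a2 subrr.
Qed.

Lemma is_adjoint_comp T T' (S S' : H -> H) :
  is_adjoint ip T T' -> is_adjoint ip S S' ->
  is_adjoint ip (T \o S) (S' \o T').
Proof. by move=> aT aS v w /=; rewrite aT aS. Qed.

Lemma is_adjoint_comb T T' (S S' : H -> H) (c : R[i]) : is_adjoint ip T T' ->
  is_adjoint ip S S' -> is_adjoint ip (c *: T + S) (c^* *: T' + S').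
Proof.
move=> aT aS v w; rewrite -[X in ip X w]/(c *: T v + S v).
rewrite -[X in ip v X]/(c^* *: T' w + S' w).
rewrite linearDl linearZl_LR linearDr linearZr_LR /= aT aS.
by rewrite -{1}[c](@conjcK R).
Qed.

(** The generated algebra is an intersection of von Neumann algebras, not a
    bicommutant, so one such algebra has to be exhibited.  The bicommutant of A
    would require adjoints of arbitrary bounded operators; the commutant of
    those elements of A' whose adjoint is known, together with M', stays inside
    M, where adjoints are at hand. *)
Lemma generated_commutes A M t t' :
  A `<=` bounded_operators (R := R) -> von_neumann_algebra ip M ->
  M = von_neumann_generated ip A ->
  commutant A t -> commutant A t' -> is_adjoint ip t t' ->
  forall z, M z -> z \o t = t \o z.
Proof.
move=> bA vM Mgen At At' adj z Mz.
have [bM adjM bicM] := vM.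
have AM : A `<=` M by rewrite Mgen => a Aa N [_]; exact.
pose X := [set s | commutant A s /\
    exists2 s', commutant A s' & is_adjoint ip s s']
  `|` commutant M.
have bX : X `<=` bounded_operators by move=> s [[[]]|[]].
suff vX : von_neumann_algebra ip (commutant X).
  have : commutant X z.
    move: Mz; rewrite Mgen; apply; split=> // a Aa; split; first exact: bA.
    by move=> s [[[_ cs] _]|[_ cs]]; rewrite cs //; exact: AM.
  by case=> _; apply; left; split=> //; exists t'.
split; [exact: commutant_bounded | | exact: commutant_tricommutant].
move=> T XT; have MT : M T.
  by rewrite -bicM; apply: commutantS XT => s; right.
have [T' MT' aT] := adjM T MT; exists T' => //; split; first exact: bM.
move=> s [[As [s' As' as']]|[_ cs]]; last by rewrite cs.
(* The adjoint of s is again one of the chosen elements of A'; taking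
   adjoints in its commutation with T gives the claim. *)
have Ts' : T \o s' = s' \o T.
  case: XT => _; apply; left; split=> //; exists s => //.
  exact: is_adjoint_sym.
apply: is_adjoint_unique (is_adjoint_comp (is_adjoint_sym as') aT) _.
by rewrite -Ts'; exact: is_adjoint_comp (is_adjoint_sym as').
Qed.

End Commutants.

Section Density.
Context {R : realType} {H : completeNormedModType R[i]}.
Context (ip : {dot H for Num.conj}) (hip : hilbert_norm ip).

(** A normal functional is a vector functional x |-> <(x (x) 1) xi, eta> on the
    amplification of M to l2(H). *)
Lemma in_predual_ell2 M f : in_predual ip M f ->
  exists xi eta, [/\ ell2 ip xi, ell2 ip eta & forall x, M x ->
    bounded_operators x -> Re (f x) = ell2_ip ip (x \o xi) eta].
Proof.
case=> xi [eta [sxi seta lim]]; exists xi, eta; split.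
- exact: square_summable_ell2.
- exact: square_summable_ell2.
move=> x Mx bx; apply/esym/cvg_lim => //; apply/cvgrPdist_le => e e0.
have e0' : 0 < e%:C :> R[i] by rewrite ltcR.
have /cvgrPdist_le/(_ _ e0')[n _ nP] := lim x Mx; exists n => // m nm.
have := nP m nm; rewrite -lecR; apply: le_trans.
rewrite /partial_ip -Re_sum -ReB; exact: normc_ge_Re.
Qed.

Context {A M : set (H -> H)} (algA : unital_algebra A)
  (adjA : self_adjoint_set ip A) (vM : von_neumann_algebra ip M)
  (Mgen : M = von_neumann_generated ip A).

(** With Xi = y xi, the vector eta is orthogonal to A Xi.  Let p be the
    projection of l2(H) onto the closure of A Xi; it commutes with A, so its
    matrix entries lie in A' and commute with z, and so p commutes with z.
    Since p Xi = Xi and p eta = 0, this gives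
    <z Xi, eta> = <z p Xi, eta> = <p z Xi, eta> = <z Xi, p eta> = 0. *)
Lemma normal_density f y : in_predual ip M f -> M y ->
  (forall a, A a -> Re (f (a \o y)) = 0) ->
  forall z, M z -> Re (f (z \o y)) = 0.
Proof.
move=> /in_predual_ell2[xi [eta [exi eeta fE]]] My fA z Mz.
have [bA Aid [A0 Alin] Acomp] := algA.
have [bM adjM _] := vM; have [_ _ _ Mcomp] := von_neumann_unital vM.
have AM : A `<=` M by rewrite Mgen => a Aa N [_]; exact.
have sL := ell2_sip ip.
pose Xi := y \o xi; pose L := ell2_ip ip.
have amp x : bounded_operators x -> forall u, ell2 ip u -> ell2 ip (x \o u).
  move=> bx u eu; have [c c0 hc] := bounded_real_ip hip bx.
  by case: (ell2_amplification c0 hc eu).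
have eXi : ell2 ip Xi by apply: amp => //; exact: bM.
have fL x : M x -> Re (f (x \o y)) = L (x \o Xi) eta.
  by move=> Mx; rewrite fE //; [exact: Mcomp | exact/bM/Mcomp].
rewrite fL //.
pose S := [set a \o Xi | a in A].
have sS : linear_subspace S.
  split; first by exists 0.
  by move=> c _ _ [a Aa <-] [b Ab <-]; exists (c *: a + b) => //; exact: Alin.
have SD : S `<=` ell2 ip by move=> _ [a Aa <-]; apply: amp => //; exact: bA.
have def := @ell2_eq0 _ _ ip.
pose P := is_projection (ell2 ip) L S.
have [p pP] : exists p, forall w, ell2 ip w -> P w (p w).
  have /choice[p pP] : forall w, exists v, ell2 ip w -> P w v.
    move=> w; have [ew|] := pselect (ell2 ip w); last by exists 0.
    have [v vP] := projection_exists sL sS SD (ell2_complete hip) ew.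
    by exists v.
  by exists p.
have pU w v : ell2 ip w -> P w v -> p w = v.
  by move=> ew; apply: (projection_unique sL sS SD def ew); exact: pP.
have pA a w : A a -> ell2 ip w -> p (a \o w) = a \o p w.
  move=> Aa ew; have ba := bA a Aa; have [a' Aa' adja] := adjA Aa.
  apply: pU; first exact: amp.
  have [c c0 hc] := bounded_real_ip hip ba.
  apply: (projection_morph sL SD (t := fun u => a \o u)
    (t' := fun u => a' \o u) (c := c)) => //; last exact: pP.
  - exact: amp.
  - by apply: amp; exact: bA.
  - by move=> u v _ _; apply/funext => k; exact: (boundedB _ _ ba).
  - by move=> u v _ _; exact: ell2_amplification_adjoint.
  - by move=> u eu; case: (ell2_amplification c0 hc eu).
  - by move=> _ [b Ab <-]; exists (a \o b); [exact: Acomp|].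
  - by move=> _ [b Ab <-]; exists (a' \o b); [exact: Acomp|].
have pD u v : ell2 ip u -> ell2 ip v -> p (u + v) = p u + p v.
  move=> eu ev; apply: pU; first exact: ell2D.
  by apply: (projectionD sL sS SD) => //; exact: pP.
have psym u v : ell2 ip u -> ell2 ip v -> L (p u) v = L u (p v).
  by move=> eu ev; apply: (projection_sym sL SD) => //; exact: pP.
have es := ell2_single ip.
(* The matrix entries of p. *)
pose T j k h := p (single j h) k.
have singleA j a h : bounded_operators a -> single j (a h) = a \o single j h.
  move=> ba; apply/funext => k /=; rewrite /single.
  by case: ifP => // _; rewrite bounded0.
have Tlin j k : linear (T j k).
  move=> c u v; rewrite /T.
  have -> : single j (c *: u + v) = (c *: id) \o single j u + single j v.
    apply/funext => i; rewrite -[RHS]/(c *: single j u i + single j v i).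
    rewrite /single.
    by case: ifP; rewrite // scaler0 addr0.
  have Ac : A (c *: id) by rewrite -[_ *: _]addr0; exact: Alin.
  by rewrite pD ?pA //; apply: amp => //; exact: bA.
have Tb j k : bounded_operators (T j k).
  apply: (contraction_bounded hip) => // h.
  have cp := (pP _ (es j h)).1.1.
  apply: (le_trans (ell2_coord_le k cp)).
  apply: (le_trans (projection_contraction sL SD (es j h) (pP _ (es j h)))).
  by rewrite ell2_ip_single /single eqxx.
have TA j k : commutant A (T j k).
  split=> // a Aa; apply/funext => h; rewrite /T /= singleA ?pA //.
  exact: bA.
have Tadj j k : is_adjoint ip (T j k) (T k j).
  apply: adjoint_of_real => // h g.
  rewrite real_ip_sym /T -ell2_ip_single (sipC sL) //; last exact: (pP _ _).1.1.
  rewrite -/L psym // /L ell2_ip_single //.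
have Tz j h : z \o p (single j h) = p (single j (z h)).
  apply/funext => k; have := generated_commutes bA vM Mgen (TA j k) (TA k j).
  by move=> /(_ (Tadj j k) z Mz) /(congr1 (fun g => g h)).
have [z' Mz' adjz] := adjM z Mz.
have ez : ell2 ip (z' \o eta) by apply: amp => //; exact: bM.
have peta : p eta = 0.
  apply: pU => //; apply: (projection_of_orthogonal sL sS SD) => //.
  move=> _ [a Aa <-]; rewrite (sipC sL) //; last by apply: amp; [exact: bA|].
  by rewrite -/L -fL ?fA //; exact: AM.
(* Tested on the sequences with one non-zero entry, where the commutation of
   p with z is the commutation of z with the entries of p. *)
have pz : p (z' \o eta) = 0.
  apply/funext => j; apply: (real_ip_eq0 (ip := ip)).
  set h := p _ j; rewrite -[X in real_ip _ _ X]/(p (z' \o eta) j).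
  rewrite -ell2_ip_single -/L -psym //.
  rewrite /L -(ell2_amplification_adjoint _ _ adjz) Tz -/L psym //.
  by rewrite peta; exact: (sip0r sL).
rewrite /L (ell2_amplification_adjoint _ _ adjz) -/L.
have pXi : p Xi = Xi.
  by apply: pU => //; apply: (projection_of_self sL SD); exists id.
by rewrite -pXi psym // pz; exact: (sip0r sL).
Qed.

End Density.
(** * The inner product of a faithful normal state *)

Section State.
Context {R : realType} {H : completeNormedModType R[i]}.
Context (ip : {dot H for Num.conj}).
Context {M : set (H -> H)} {psi : (H -> H) -> R[i]}.

(** The adjoint is a relation on functions; the default value is never met on
    a von Neumann algebra. *)
Definition adjoint_in (x : H -> H) : H -> H :=
  xget 0 [set x' | M x' /\ is_adjoint ip x x'].

Definition state_ip (x y : H -> H) : R := Re (psi (adjoint_in y \o x)).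

Context (vM : von_neumann_algebra ip M) (psiM : faithful_normal_state ip M psi).

Lemma adjoint_inP x : M x -> M (adjoint_in x) /\ is_adjoint ip x (adjoint_in x).
Proof.
case: vM => _ adjM _ /adjM[x' Mx' adjx].
exact: (@xgetPex _ 0 [set x' | M x' /\ is_adjoint ip x x']
  (ex_intro _ x' (conj Mx' adjx))).
Qed.

Lemma adjoint_inE x x' : M x -> is_adjoint ip x x' -> adjoint_in x = x'.
Proof. by move=> /adjoint_inP[_ h] h'; exact: is_adjoint_unique h h'. Qed.

Lemma state_ipE x y y' : M y -> is_adjoint ip y y' ->
  state_ip x y = Re (psi (y' \o x)).
Proof. by move=> My /(adjoint_inE My); rewrite /state_ip => ->. Qed.

Lemma state_ge0 x : M x -> 0 <= psi (adjoint_in x \o x).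
Proof.
by case: psiM => _ _ pos _ _ Mx; apply: pos => //; case: (adjoint_inP Mx).
Qed.

(** Symmetry is the vanishing of the imaginary part of
    psi((ix + y)* (ix + y)). *)
Lemma state_sip : semi_inner_product M state_ip.
Proof.
have [lin _ pos _ _] := psiM; have [bM _ _] := vM.
have [_ _ sM Mcomp] := von_neumann_unital vM.
split=> //; last by move=> x Mx; exact/Re_ge0/state_ge0.
- move=> x y Mx My.
  have [Mx' adjx] := adjoint_inP Mx; have [My' adjy] := adjoint_inP My.
  pose z := 'i *: x + y; pose z' := ('i)^* *: adjoint_in x + adjoint_in y.
  have adjz : is_adjoint ip z z' by exact: is_adjoint_comb.
  have Mz : M z by case: sM => _; apply.
  have zz : z' \o z = ('i * ('i)^*) *: (adjoint_in x \o x) +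
      (('i)^* *: (adjoint_in x \o y) + ('i *: (adjoint_in y \o x)
       + (adjoint_in y \o y))).
    apply/funext => v; rewrite -[LHS]/(('i)^* *: adjoint_in x ('i *: x v + y v)
      + adjoint_in y ('i *: x v + y v)).
    rewrite (bounded_linear _ _ _ (bM _ Mx')) (bounded_linear _ _ _ (bM _ My')).
    by rewrite scalerDr scalerA mulrC -addrA.
  have := pos z z' Mz adjz; rewrite zz.
  have Mc a u v : M u -> M v -> M (a *: u + v) by case: sM => _; apply.
  have [xx xy] := (Mcomp _ _ Mx' Mx, Mcomp _ _ Mx' My).
  have [yx yy] := (Mcomp _ _ My' Mx, Mcomp _ _ My' My).
  have M1 := Mc 'i _ _ yx yy; have M2 := Mc ('i)^* _ _ xy M1.
  rewrite (lin _ _ _ xx M2) (lin _ _ _ xy M1) (lin _ _ _ yx yy).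
  have := state_ge0 Mx; have := state_ge0 My; rewrite /state_ip.
  case: (psi (adjoint_in x \o x)) => a b.
  case: (psi (adjoint_in x \o y)) => c d.
  case: (psi (adjoint_in y \o x)) => e f.
  case: (psi (adjoint_in y \o y)) => g h.
  rewrite !lecE /= => /andP[/eqP h0 _] /andP[/eqP b0 _] /andP[/eqP + _].
  by rewrite h0 b0; lra.
- move=> t x y z Mx My Mz; have [Mz' adjz] := adjoint_inP Mz.
  rewrite /state_ip.
  have -> : adjoint_in z \o (t%:C *: x + y) =
      t%:C *: (adjoint_in z \o x) + (adjoint_in z \o y).
    apply/funext => v; exact: (bounded_linear _ _ _ (bM _ Mz')).
  rewrite lin; [|exact: Mcomp|exact: Mcomp].
  by rewrite ReD Re_realM.
Qed.

Lemma state_ip_eq0 x : M x -> state_ip x x = 0 -> x = 0.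
Proof.
case: (psiM) => _ _ _ faith _ Mx x0; have [_ adjx] := adjoint_inP Mx.
apply: (faith x _ Mx adjx); rewrite (ge0_ReE (state_ge0 Mx)).
by rewrite -[Re _]/(state_ip x x) x0.
Qed.

Lemma automorphism_M f x : automorphism ip M psi f -> M x -> M (f x).
Proof. by case=> [[fun_f _ _] _ _ _ _] Mx; exact: fun_f. Qed.

Lemma automorphism_state_ip f x y : automorphism ip M psi f -> M x -> M y ->
  state_ip (f x) (f y) = state_ip x y.
Proof.
move=> autf Mx My; have [_ _ fM fadj fpsi] := autf.
have [My' adjy] := adjoint_inP My.
rewrite (@state_ipE _ _ (f (adjoint_in y))); last exact: fadj.
- have [_ _ _ Mcomp] := von_neumann_unital vM.
  by rewrite -fM // fpsi //; exact: Mcomp.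
- exact: automorphism_M.
Qed.

(** The expectation is the orthogonal projection onto N, since
    psi(a* E(x)) = psi(E(a* x)) = psi(a* x). *)
Lemma conditional_expectation_state_ip N E x a :
  von_neumann_algebra ip N -> N `<=` M ->
  conditional_expectation ip M psi N E -> M x -> N a ->
  state_ip (E x) a = state_ip x a.
Proof.
move=> vN NM [_ _ bimod _ Epsi] Mx Na; have [_ adjN _] := vN.
have [a' Na' adja] := adjN a Na; have Ma := NM _ Na; have Ma' := NM _ Na'.
have [_ Nid _ _] := von_neumann_unital vN.
have [_ _ _ Mcomp] := von_neumann_unital vM.
rewrite !(state_ipE _ Ma adja).
have -> : a' \o E x = E (a' \o x) by exact: (esym (bimod a' x id Na' Mx Nid)).
by rewrite Epsi //; exact: Mcomp.
Qed.

End State.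

(** * Towers of commuting squares *)

Section Tower.
Context {R : realType} {H : completeNormedModType R[i]}.
Context (ip : {dot H for Num.conj}) (hip : hilbert_norm ip).
Context {M : set (H -> H)} {psi : (H -> H) -> R[i]}.
Context (vM : von_neumann_algebra ip M) (psiM : faithful_normal_state ip M psi).
Context {T : nat -> set (H -> H)} {a : nat -> (H -> H) -> (H -> H)}.
(* The tower is indexed from 0, so that T n is M_(n-1), and a n is the n-th
   factor; the commuting square for n then has T n and its image under a n
   inside T n.+1, with T n.-1 in their intersection. *)
Context (T_cond : forall n, conditioned_subalgebra ip M psi (T n))
  (T_incr : forall n, T n `<=` T n.+1)
  (T_gen : M = von_neumann_generated ip (\bigcup_n T n)).
Context (a_aut : forall k, (1 <= k)%N -> automorphism ip M psi (a k))
  (a_fix : forall n k x, (n < k)%N -> T n x -> a k x = x)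
  (a_stable : forall n k x, (1 <= k < n)%N -> T n x -> T n (a k x)).
Context (squares : forall n, (1 <= n)%N ->
  commuting_square ip M psi (T n) (T n.+1) (T n.-1) (a n @` T n)).

Local Notation s := (@state_ip R H ip M psi).

Lemma tower_vn n : von_neumann_algebra ip (T n).
Proof. by case: (T_cond n). Qed.

Lemma tower_sub n : T n `<=` M.
Proof. by case: (T_cond n). Qed.

Lemma tower_le m n : (m <= n)%N -> T m `<=` T n.
Proof.
move=> /subnKC <-; elim: (n - m)%N => [|k ih]; first by rewrite addn0.
by rewrite addnS => x /ih; exact: T_incr.
Qed.

(** For b in T n, projecting to the image a_n(T n) is, by the commuting square,
    the same as projecting to T (n-1), where a_n is the identity.  So
    <a_n d, b> = <a_n d, E b> = <a_n d, a_n (E b)> = <d, E b> = 0. *)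
Lemma square_orthogonal n d : (1 <= n)%N -> T n d ->
  (forall b, T n.-1 b -> s d b = 0) -> forall b, T n b -> s (a n d) b = 0.
Proof.
move=> n1 Td orth b Tb.
have [[_ _ _ [vN1 N1M _]] _ [E1 [E2 [E [hE1 hE2 hE E12]]]]] := squares n1.
have ssip := state_sip vM psiM.
have Mb := tower_sub Tb; have Md := tower_sub Td.
have Mad : M (a n d) by exact: automorphism_M (a_aut n1) Md.
have TE : T n.-1 (E b) by case: hE => -[+ _] _ _ _ _; apply.
have E1b : E1 b = E b.
  by rewrite -E12 //; case: hE2 => -[_ ->].
have ME : M (E b) by exact: tower_sub TE.
rewrite (sipC ssip) // -(conditional_expectation_state_ip vM vN1 N1M hE1 Mb).
  rewrite E1b -(@a_fix n.-1 n (E b)) ?prednK //.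
  rewrite (automorphism_state_ip vM (a_aut n1)) // (sipC ssip) // orth //.
by exists d.
Qed.

(** The image a_(m+j) ... a_(m+1) d of d.  If d lies in T (m+1) and is
    orthogonal to T m, each image is new relative to the level that contains
    all the earlier ones. *)
Fixpoint shifted_copy (m : nat) (d : H -> H) (j : nat) : H -> H :=
  if j is i.+1 then a (m + i).+1 (shifted_copy m d i) else d.

Lemma shifted_copy_tower m d j : T m.+1 d -> T (m + j).+1 (shifted_copy m d j).
Proof.
move=> Td; elim: j => [|j ih] /=; first by rewrite addn0.
by rewrite addnS; apply: a_stable; [rewrite ltnS leqnn|exact: T_incr].
Qed.

Lemma shifted_copy_orthogonal m d j : T m.+1 d ->
  (forall b, T m b -> s d b = 0) ->
  forall b, T (m + j)%N b -> s (shifted_copy m d j) b = 0.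
Proof.
move=> Td orth; elim: j => [|j ih] /=; first by rewrite addn0.
by rewrite addnS; apply: square_orthogonal => //; exact: shifted_copy_tower.
Qed.

Lemma tower_expectation m : exists E, conditional_expectation ip M psi (T m) E.
Proof. by case: (T_cond m). Qed.

(** The difference d of the two expectations is shown to have norm zero: its
    shifted copies are orthogonal vectors of equal norm, and all have the same
    inner product <d, d> with the fixed vector x. *)
Lemma expectation_stationary m x E E' : M x ->
  (forall k, (m < k)%N -> a k x = x) ->
  conditional_expectation ip M psi (T m) E ->
  conditional_expectation ip M psi (T m.+1) E' -> E' x = E x.
Proof.
move=> Mx fx hE hE'; have ssip := state_sip vM psiM.
have TE : T m (E x) by case: hE => -[+ _] _ _ _ _; apply.
have TE' : T m.+1 (E' x) by case: hE' => -[+ _] _ _ _ _; apply.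
have [sM _ _ _] := ssip; have TM := tower_sub.
have ME := TM _ _ TE; have ME' := TM _ _ TE'.
pose d := E' x - E x.
have Td : T m.+1 d.
  have [_ _ sT _] := von_neumann_unital (tower_vn m.+1).
  by apply: (subspaceB sT) => //; exact: T_incr.
have Md := TM _ _ Td.
have orth b : T m b -> s d b = 0.
  move=> Tb; have Mb := TM _ _ Tb; rewrite (sipBl ssip) //.
  rewrite (conditional_expectation_state_ip vM (tower_vn m) (@TM m) hE) //.
  rewrite (conditional_expectation_state_ip vM (tower_vn m.+1) (@TM m.+1) hE')
    //.
    by rewrite subrr.
  exact: T_incr.
pose D := shifted_copy m d.
have TD j : T (m + j).+1 (D j) by exact: shifted_copy_tower.
have MD j : M (D j) by exact: TM (TD j).
have aj j : automorphism ip M psi (a (m + j).+1) by exact: a_aut.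
have inner : s x d = s d d.
  have <- : s (E' x) d = s x d.
    exact: (conditional_expectation_state_ip vM (tower_vn m.+1) (@TM m.+1) hE').
  rewrite {2}/d (sipBl ssip) // [X in _ - X](sipC ssip) // orth //.
  by rewrite subr0.
suff /(state_ip_eq0 vM psiM Md) : s d d = 0.
  by move/eqP; rewrite subr_eq0 => /eqP.
apply: (orthogonal_copies_null ssip (d := D) (x := x)) => //.
- move=> i j ij; rewrite (sipC ssip) //; apply: shifted_copy_orthogonal => //.
  by apply: tower_le (TD i); rewrite -addnS leq_add2l.
- elim=> [//|j ih] /=; rewrite (automorphism_state_ip vM (aj j)) //; exact: MD.
- elim=> [//|j ih] /=; rewrite -{1}(fx (m + j).+1) ?ltnS ?leq_addr //.
  by rewrite (automorphism_state_ip vM (aj j)) //; exact: MD.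
Qed.

Lemma tower_union_algebra : unital_algebra (\bigcup_n T n).
Proof.
have alg n := von_neumann_unital (tower_vn n); split.
- by move=> x [n _]; case: (alg n) => b _ _ _ /b.
- by exists 0%N => //; case: (alg 0%N).
- split; first by exists 0%N => //; case: (alg 0%N) => _ _ [].
  move=> c x y [m _ Tx] [n _ Ty]; exists (maxn m n) => //.
  case: (alg (maxn m n)) => _ _ [_ lin] _.
  by apply: lin; [apply: tower_le Tx; exact: leq_maxl
                 |apply: tower_le Ty; exact: leq_maxr].
- move=> x y [m _ Tx] [n _ Ty]; exists (maxn m n) => //.
  case: (alg (maxn m n)) => _ _ _; apply.
    by apply: tower_le Tx; exact: leq_maxl.
  by apply: tower_le Ty; exact: leq_maxr.
Qed.

Lemma tower_union_self_adjoint : self_adjoint_set ip (\bigcup_n T n).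
Proof.
move=> x [n _ Tx]; have [_ adjT _] := tower_vn n.
by have [x' Tx' adjx] := adjT x Tx; exists x' => //; exists n.
Qed.

(** The functional z |-> psi(z y) vanishes on the union of the tower, hence by
    density on M, in particular at z = y*. *)
Lemma orthogonal_to_tower_null y : M y ->
  (forall n b, T n b -> s y b = 0) -> y = 0.
Proof.
move=> My orth; apply: (state_ip_eq0 vM psiM My).
have [My' adjy] := adjoint_inP vM My; have [_ _ _ _ pre] := psiM.
apply: (normal_density hip tower_union_algebra tower_union_self_adjoint
  vM T_gen pre My _ My') => b Ub.
have [b' [n _ Tb'] adjb] := tower_union_self_adjoint Ub.
rewrite -(state_ipE vM y (tower_sub Tb') (is_adjoint_sym adjb)).
exact: orth Tb'.
Qed.

Lemma fixed_points_tower m :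
  T m = [set x | M x /\ forall k, (m < k)%N -> a k x = x].
Proof.
apply/seteqP; split=> x.
  move=> Tx; split; first exact: tower_sub Tx.
  by move=> k mk; exact: a_fix Tx.
move=> [Mx fx]; have ssip := state_sip vM psiM.
have /choice[E hE] := tower_expectation.
have TE : T m (E m x) by case: (hE m) => -[+ _] _ _ _ _; apply.
have ME := tower_sub TE.
have stat n : E (m + n)%N x = E m x.
  elim: n => [|n <-]; first by rewrite addn0.
  rewrite addnS; apply: (expectation_stationary Mx _ (hE _) (hE _)) => k mk.
  by apply: fx; exact: leq_ltn_trans (leq_addr _ _) mk.
suff : x - E m x = 0 by move/eqP; rewrite subr_eq0 => /eqP ->.
apply: orthogonal_to_tower_null => [|n b Tb].
  exact: subspaceB (sip_sub ssip) Mx ME.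
have Tb' : T (m + n)%N b by apply: tower_le Tb; exact: leq_addl.
have Mb := tower_sub Tb.
rewrite (sipBl ssip) // -(stat n).
rewrite (conditional_expectation_state_ip vM (tower_vn _) (@tower_sub _) (hE _))
  //.
by rewrite subrr.
Qed.

End Tower.
(** * Adapted endomorphisms and the braid group *)

Section BraidFixedPoints.
Context {R : realType} {H : completeNormedModType R[i]}.
Context (ip : {dot H for Num.conj}).
Context {M : set (H -> H)} {psi : (H -> H) -> R[i]}.

Lemma representation_one rho x : braid_representation ip M psi rho -> M x ->
  rho 1%g x = x.
Proof.
move=> [aut mul] Mx; have [[_ inj _] _ _ _ _] := aut 1%g.
have Mrx : M (rho 1%g x) by exact: automorphism_M (aut _) Mx.
by apply: inj; rewrite ?inE // -mul // mulg1.
Qed.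

Lemma fixed_by_generators rho n : braid_representation ip M psi rho ->
  fixed_points_of M rho (braid_subgroup n) =
  [set x | M x /\ forall k, (n <= k)%N -> rho (sigma k) x = x].
Proof.
move=> rep; have [aut mul] := rep; apply/seteqP; split=> x [Mx fx]; split=> //.
  move=> k nk; apply: fx => B [gen _ _ _]; apply: gen; by exists k.
move=> g /(_ [set g | rho g x = x]); apply; split=> /=.
- by move=> _ [k nk ->]; exact: fx.
- exact: representation_one rep Mx.
- by move=> g1 g2 f1 f2; rewrite mul // f2.
- move=> g1 f1; rewrite -{1}f1 -mul // mulVg.
  exact: representation_one rep Mx.
Qed.

End BraidFixedPoints.

Section AdaptedEndomorphism.
Context {R : realType} {H : completeNormedModType R[i]}.
Context (ip : {dot H for Num.conj}).
Context {M : set (H -> H)} {psi : (H -> H) -> R[i]}.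

(** All later factors act trivially on the bottom of the tower, so the partial
    products are constant there from the first one on. *)
Lemma fixed_by_first_factor tower alpha alphas x :
  adapted_with_product_representation ip M psi tower alpha alphas ->
  M x -> tower 0%N x -> alpha x = x -> alphas 1%N x = x.
Proof.
move=> [_ _ fix_tower lim] Mx Tx alphax; apply/funext => v.
have prod n : partial_product alphas n.+1 x = alphas 1%N x.
  by elim: n => [//|n ih]; rewrite -[LHS]/(partial_product alphas n.+1 _)
    (fix_tower 0%N).
rewrite -[in RHS]alphax; apply: (cvg_unique _ _ (lim x Mx v)) => //.
apply: cvg_near_cst; exists 1%N => // -[|n] //= _.
by rewrite -[LHS]/(partial_product alphas n.+1 x v) prod.
Qed.

Lemma Ad_fixed_points u f x : M `<=` bounded_operators (R := R) ->
  unitary_in ip M u -> is_Ad ip M u f -> M x -> f x = x <-> x \o u = u \o x.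
Proof.
move=> bM [Mu [u' adju [uu' u'u]]] fE Mx; rewrite (fE u' adju x Mx).
split=> [fx|cx]; last by rewrite -cx -compA uu'.
by rewrite -[in LHS]fx -(compA (u \o x) u' u) u'u.
Qed.

End AdaptedEndomorphism.

Theorem theoremA12 (R : realType) (H : completeNormedModType R[i])
    (ip : {dot H for Num.conj}) (hip : hilbert_norm ip)
    (M : set (H -> H)) (psi : (H -> H) -> R[i])
    (hM : probability_space ip M psi)
    (tower : nat -> set (H -> H))
    (tower_cond : forall n, conditioned_subalgebra ip M psi (tower n))
    (tower_incr : forall n, tower n `<=` tower n.+1)
    (tower_gen : M = von_neumann_generated ip (\bigcup_n tower n))
    (alpha : (H -> H) -> (H -> H))
    (alphas : nat -> (H -> H) -> (H -> H))
    (alpha_adapted :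
       adapted_with_product_representation ip M psi tower alpha alphas)
    (Mm1 : set (H -> H))
    (Mm1_cond : conditioned_subalgebra ip M psi Mm1)
    (Mm1_sub : Mm1 `<=` fixed_points M alpha `&` tower 0%N)
    (squares : forall n, (1 <= n)%N ->
       commuting_square ip M psi
         (tower n.-1) (tower n)
         (shifted_tower Mm1 tower n.-1) (alphas n @` tower n.-1))
    (rho : braid_group -> (H -> H) -> (H -> H))
    (rho_rep : braid_representation ip M psi rho)
    (rho_sigma : forall k, (1 <= k)%N ->
       forall x, M x -> alphas k x = rho (sigma k) x) :
  (* [m] stands for n + 1 with n >= -1 *)
  (forall m, shifted_tower Mm1 tower m =
             fixed_points_of M rho (braid_subgroup m.+1)) /\
  (forall m (u : nat -> H -> H),
     (forall k, (m.+1 <= k)%N ->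
        unitary_in ip M (u k) /\ is_Ad ip M (u k) (rho (sigma k))) ->
     shifted_tower Mm1 tower m =
     M `&` commutant [set u k | k in [set k | (m.+1 <= k)%N]]).
Proof.
have [vM _ psiM] := hM; have [bM _ _] := vM.
have [aut stable fixT _] := alpha_adapted.
pose T := shifted_tower Mm1 tower.
have T_incr n : T n `<=` T n.+1.
  by case: n => [|n] x /=; [case/Mm1_sub | exact: tower_incr].
have T_gen : M = von_neumann_generated ip (\bigcup_n T n).
  rewrite [LHS]tower_gen; congr (von_neumann_generated ip).
  apply/seteqP; split=> x [n _ Tx]; first by exists n.+1.
  by exists n => //; exact: (T_incr n).
have T_fix n k x : (n < k)%N -> T n x -> alphas k x = x.
  case: n => [|n] nk Tx; last exact: fixT nk x Tx.
  have [[Mx alphax] T0x] := Mm1_sub _ Tx.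
  case: k nk => [//|[_|k _]]; last exact: (fixT 0%N).
  exact: fixed_by_first_factor alpha_adapted Mx T0x alphax.
have T_stable n k x : (1 <= k < n)%N -> T n x -> T n (alphas k x).
  case: n => [|n]; first by rewrite ltn0 andbF.
  by move=> kn Tx; rewrite /= -(stable n k kn); exists x.
have T_cond n : conditioned_subalgebra ip M psi (T n) by case: n.
have T_squares n : (1 <= n)%N ->
    commuting_square ip M psi (T n) (T n.+1) (T n.-1) (alphas n @` T n).
  by case: n => [//|n] _; exact: (squares n.+1 isT).
have sigma_fixed m : T m =
    [set x | M x /\ forall k, (m.+1 <= k)%N -> rho (sigma k) x = x].
  rewrite (fixed_points_tower hip vM psiM T_cond T_incr T_gen aut T_fix
    T_stable T_squares).
  apply/seteqP; split=> x [Mx fx]; split=> // k mk.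
    by rewrite -rho_sigma ?fx //; exact: leq_ltn_trans mk.
  by rewrite rho_sigma ?fx //; exact: leq_ltn_trans mk.
split=> [m|m u uP].
  by rewrite (fixed_by_generators _ rho_rep) -sigma_fixed.
rewrite -/(T m) sigma_fixed; apply/seteqP; split=> x [Mx].
  move=> fx; split=> //; split; first exact: bM.
  move=> _ [k mk <-]; have [uk Adk] := uP k mk.
  exact/(Ad_fixed_points bM uk Adk Mx)/fx.
move=> [_ cx]; split=> // k mk; have [uk Adk] := uP k mk.
by apply/(Ad_fixed_points bM uk Adk Mx)/cx; exists k.
Qed.
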